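(* Let $G_1$ be an $r_1$-regular graph on $n_1$ vertices and $m_1$ edges, and $G_2$ an arbitrary graph on $n_2$ vertices. Then $$Kf(G_1\dot{\vee} G_2)=(m_1+n_1+n_2)\left(\frac{m_1-n_1}{2}+\frac{2+r_1+n_1+n_2}{2n_1+2n_2+n_1r_1}+\sum_{i=2}^{n_2}\frac{1}{n_1+\mu_i(G_2)}+\sum_{i=2}^{n_1}\frac{2+r_1+n_2}{2n_2+\mu_i(G_1)}\right).$$
   Context: All graphs are finite, simple and undirected, with at least one vertex. For a graph $G$ on $n$ vertices, $0=\mu_1(G)\le\mu_2(G)\le\cdots\le\mu_n(G)$ are the eigenvalues of the Laplacian matrix $L(G)=D(G)-A(G)$ ($D(G)$ the diagonal degree matrix, $A(G)$ the adjacency matrix). The Kirchhoff index $Kf(G)$ of a connected graph $G$ is the sum, over all unordered pairs of vertices, of the resistance distances (effective resistances when each edge is a unit resistor); for a connected graph on $n\ge 2$ vertices it is known that $Kf(G)=n\sum_{i=2}^{n}\frac{1}{\mu_i(G)}$. The subdivision graph $\mathcal{S}(G)$ is obtained from $G$ by inserting a new vertex into every edge of $G$. For vertex-disjoint graphs $G_1,G_2$, the subdivision-vertex join $G_1\dot{\vee}G_2$ is the graph obtained from $\mathcal{S}(G_1)$ and $G_2$ by joining every vertex of $V(G_1)$ (the original vertices) with every vertex of $V(G_2)$. *)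

(* Defs.v *)
From mathcomp Require Import all_boot all_order all_algebra.
From mathcomp Require Import polyrcf.
From mathcomp Require Import classical_sets reals.

Set Implicit Arguments.
Unset Strict Implicit.
Unset Printing Implicit Defensive.

Import Order.TTheory GRing.Theory Num.Theory.
Local Open Scope ring_scope.

Record graph := Graph {
  vertex :> finType;
  adj : rel vertex;
  adj_sym : symmetric adj;
  adj_irr : irreflexive adj;
  vertex_gt0 : (0 < #|vertex|)%N
}.

Definition edges (G : graph) : {set {set G}} :=
  [set e : {set G} | [exists x, [exists y, adj x y && (e == [set x; y])]]].

Definition degree (G : graph) (x : G) : nat := #|[set y | adj x y]|.

Definition regular (G : graph) (r : nat) : Prop := forall x : G, degree x = r.

Section Laplacian.
Variables (R : realType) (G : graph).

Definition degree_mx : 'M[R]_#|G| :=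
  diag_mx (\row_i (degree (enum_val i))%:R).

Definition adjacency_mx : 'M[R]_#|G| :=
  \matrix_(i, j) (adj (enum_val i) (enum_val j))%:R.

Definition laplacian_mx : 'M[R]_#|G| := degree_mx - adjacency_mx.

(* [rootsR] lists the distinct real roots of the characteristic polynomial;
   each of them is repeated according to its multiplicity. *)
Definition laplacian_spectrum : seq R :=
  let p := char_poly laplacian_mx in
  sort <=%R (flatten [seq nseq (mup x p) x | x <- rootsR p]).

(* Eigenvalues are numbered from 1, in nondecreasing order. *)
Definition laplacian_eigenvalue (i : nat) : R := laplacian_spectrum`_i.-1.

(* [p] is an electrical potential for a unit current entering the network at
   [u] and leaving it at [v]: by Ohm's law the current from [w] to a
   neighbour [x] is [p w - p x], and Kirchhoff's current law holds at every
   vertex. *)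
Definition unit_current_potential (u v : G) (p : G -> R) : Prop :=
  forall w : G,
    \sum_(x | adj w x) (p w - p x) = (w == u)%:R - (w == v)%:R.

(* The voltage between [u] and [v] under a unit current.  It exists and does
   not depend on the potential when [G] is connected; between vertices in
   different components no potential exists and the value is 0 by
   convention. *)
Definition resistance_distance (u v : G) : R :=
  xget 0 [set r | exists2 p, unit_current_potential u v p & r = p u - p v].

(* The order given by [enum_rank] selects each unordered pair once. *)
Definition kirchhoff_index : R :=
  \sum_(u : G) \sum_(v : G | (enum_rank u < enum_rank v)%N)
    resistance_distance u v.

End Laplacian.

Section Subdivision.
Variable G : graph.

Definition subdivision_vertex : finType :=
  (G + {e : {set G} | e \in edges G})%type.

Definition subdivision_adj (a b : subdivision_vertex) : bool :=
  match a, b with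
  | inl x, inr e | inr e, inl x => x \in val e
  | _, _ => false
  end.

Fact subdivision_sym : symmetric subdivision_adj.
Proof. by case=> a [b|b]. Qed.

Fact subdivision_irr : irreflexive subdivision_adj.
Proof. by case. Qed.

Fact subdivision_gt0 : (0 < #|subdivision_vertex|)%N.
Proof. by rewrite card_sum addn_gt0 vertex_gt0. Qed.

Definition subdivision : graph :=
  Graph subdivision_sym subdivision_irr subdivision_gt0.

End Subdivision.

Section SubdivisionVertexJoin.
Variables G1 G2 : graph.

Definition svjoin_vertex : finType := (subdivision G1 + G2)%type.

Definition svjoin_adj (a b : svjoin_vertex) : bool :=
  match a, b with
  | inl x, inl y => adj x y
  | inr x, inr y => adj x y
  | inl (inl _), inr _ | inr _, inl (inl _) => true
  | inl (inr _), inr _ | inr _, inl (inr _) => false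
  end.

Fact svjoin_sym : symmetric svjoin_adj.
Proof. by case=> [[a|a]|a] [[b|b]|b] //; apply: adj_sym. Qed.

Fact svjoin_irr : irreflexive svjoin_adj.
Proof. by case=> [[a|a]|a] //; apply: adj_irr. Qed.

Fact svjoin_gt0 : (0 < #|svjoin_vertex|)%N.
Proof. by rewrite card_sum addn_gt0 vertex_gt0. Qed.

Definition subdivision_vertex_join : graph :=
  Graph svjoin_sym svjoin_irr svjoin_gt0.

End SubdivisionVertexJoin.

(* Main.v *)
(** If a matrix [M] satisfies [L M = I - c 1^T], where [L] is the Laplacian of a
    graph on [n] vertices, then by symmetry of [L] every harmonic [p] has
    [p s = <p, c>] for all [s], so that potentials are unique up to a constant,
    the columns of [M] give the resistances and [Kf = n tr M - 1^T M 1].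
    For the join, eliminating the subdivision vertices with [B B^T = 2 r1 - L1]
    ([B] the incidence matrix of [G1]) and putting [P = (2 n2 + L1)^-1] and
    [Q = (n1 + L2)^-1], such an [M] is
      [2 P     P B                        0          ]
      [B^T P   (I + B^T P B) / 2          0          ]
      [0       0                    Q - J / (n1 n2)  ]
    in the block order [V(G1)], [E(G1)], [V(G2)].  The traces of [P] and [Q] are
    read off the Laplacian spectra. *)
Require Import Defs.
From mathcomp Require Import all_boot all_order all_algebra.
From mathcomp Require Import ring lra polyrcf complex.
From mathcomp Require Import classical_sets reals.

Set Implicit Arguments.
Unset Strict Implicit.
Unset Printing Implicit Defensive.

Import Order.TTheory GRing.Theory Num.Theory.
Local Open Scope ring_scope.

(** * Spectrum and resolvent trace of a real symmetric matrix *)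

Lemma char_poly_conj {F : fieldType} n (P A : 'M[F]_n) :
  P \in unitmx -> char_poly (invmx P *m A *m P) = char_poly A.
Proof.
move=> Punit; pose Q := map_mx polyC P; pose Q' := map_mx polyC (invmx P).
have QQ : Q' *m Q = 1%:M by rewrite -map_mxM mulVmx // map_mx1.
have -> : char_poly (invmx P *m A *m P) = \det (Q' *m char_poly_mx A *m Q).
  rewrite /char_poly; congr (\det _).
  rewrite /char_poly_mx mulmxBr mulmxBl !map_mxM -/Q -/Q' scalar_mxC.
  by rewrite -(mulmxA 'X%:M) QQ mulmx1.
by rewrite !det_mulmx mulrAC -det_mulmx QQ det1 mul1r.
Qed.

Lemma trace_inv_conj_diag (F : fieldType) n (P : 'M[F]_n) (d : 'rV[F]_n) a :
  P \in unitmx -> a%:M + invmx P *m diag_mx d *m P \in unitmx ->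
  \tr (invmx (a%:M + invmx P *m diag_mx d *m P)) = \sum_j (a + d 0 j)^-1.
Proof.
move=> Punit; set D := diag_mx (\row_j (a + d 0 j)).
have -> : a%:M + invmx P *m diag_mx d *m P = invmx P *m D *m P.
  rewrite -[a%:M]mulmx1 -[1%:M](mulVmx Punit) mulmxA -scalar_mxC -mulmxDl.
  rewrite -mulmxDr; congr (_ *m _ *m _).
  by apply/matrixP => i j; rewrite !mxE -mulrnDl.
(* Invertibility of the whole matrix forces that of its diagonal factor, so no [a + d 0 j]
   vanishes. *)
rewrite !unitmx_mul => /andP[/andP[_ Dunit] _].
have dunit j : a + d 0 j != 0.
  move: Dunit; rewrite unitmxE det_diag unitfE => /prodf_neq0 /(_ j isT).
  by rewrite mxE.
set DI := diag_mx (\row_j (a + d 0 j)^-1).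
have DDI : D *m DI = 1%:M.
  rewrite mulmx_diag; apply/matrixP => i j; rewrite !mxE.
  by case: eqP => [->|]; rewrite ?mulr1n ?mulfV ?dunit ?mulr0n.
have -> : invmx (invmx P *m D *m P) = invmx P *m DI *m P.
  have Q : (invmx P *m DI *m P) *m (invmx P *m D *m P) = 1%:M.
    rewrite !mulmxA mulmxK // -[_ *m DI *m D]mulmxA.
    by rewrite (mulmx1C DDI) mulmx1 mulVmx.
  have [U _] := mulmx1_unit (mulmx1C Q).
  by rewrite -[LHS]mul1mx -Q mulmxK.
rewrite mxtrace_mulC mulmxA mulmxV // mul1mx mxtrace_diag.
by apply: eq_bigr => j _; rewrite mxE.
Qed.

(** Over [R[i]] a real symmetric matrix is Hermitian, so the spectral theorem applies. The
    eigenvalues are real, so [d] can live over [R] even though [P] is complex. *)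
Lemma symmetric_mx_diag (R : rcfType) n (A : 'M[R]_n) : A^T = A ->
  exists (P : 'M[R[i]]_n) (d : 'rV[R]_n), P \in unitmx /\
    map_mx (real_complex R) A =
    invmx P *m diag_mx (map_mx (real_complex R) d) *m P.
Proof.
move=> Asym; set B := map_mx _ A.
have Breal : B \is a mxOver Num.real.
  by apply/mxOverP => i j; rewrite mxE; apply/complex_realP; exists (A i j).
have Bherm : B \is hermsymmx.
  apply: realsym_hermsym => //; apply/is_hermitianmxP.
  by apply/matrixP => i j; rewrite expr0 scale1r !mxE /= -{1}Asym mxE.
have spR := hermitian_spectral_diag_real Bherm.
have /hermitian_normalmx/orthomx_spectralP BE := Bherm.
move: (spectralmx B) (spectral_diag B) (spectral_unit B) spR BE.
move=> P sp Punit /mxOverP spR BE.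
exists P, (\row_j complex.Re (sp 0 j)); split; first exact: Punit.
have -> : map_mx (real_complex R) (\row_j complex.Re (sp 0 j)) = sp.
  by apply/rowP => j; rewrite !mxE RRe_real.
exact: BE.
Qed.

(** Both identities are checked over [R[i]] on the diagonal form and pulled back along the injective
    embedding of [R]. *)
Lemma symmetric_mx_spectrum (R : rcfType) n (A : 'M[R]_n) : A^T = A ->
  exists2 rs : seq R, char_poly A = \prod_(x <- rs) ('X - x%:P) &
    forall a, a%:M + A \in unitmx ->
      \tr (invmx (a%:M + A)) = \sum_(x <- rs) (a + x)^-1.
Proof.
move=> /symmetric_mx_diag[P [d [Punit AE]]]; pose rc := real_complex R.
exists [seq d 0 j | j <- enum 'I_n].
  apply: (@map_poly_inj _ _ rc).
  rewrite map_char_poly AE char_poly_conj // char_poly_trig; last first.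
    exact/diag_mx_is_trig.
  rewrite rmorph_prod big_map big_enum /=; apply: eq_bigr => j _.
  by rewrite map_polyXsubC !mxE eqxx mulr1n.
move=> a; rewrite -(map_unitmx rc) => aAunit; apply: (fmorph_inj rc).
move: aAunit; rewrite -trace_map_mx map_invmx map_mxD map_scalar_mx AE.
move=> aAunit.
rewrite trace_inv_conj_diag // rmorph_sum big_map big_enum.
by apply: eq_bigr => j _; rewrite mxE -rmorphD -fmorphV.
Qed.

Lemma mup_prod_XsubC (F : fieldType) (x : F) (rs : seq F) :
  mup x (\prod_(y <- rs) ('X - y%:P)) = count_mem x rs.
Proof.
elim: rs => [|y rs IH]; first by rewrite big_nil mupNroot // root1.
rewrite big_cons mupM ?monic_neq0 ?monicXsubC ?monic_prod_XsubC //.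
by rewrite IH -[in LHS](expr1 ('X - _)) mup_XsubCX /=; case: eqP.
Qed.

Lemma perm_rootsR_mup (R : rcfType) (rs : seq R)
    (p := \prod_(y <- rs) ('X - y%:P)) :
  perm_eq (flatten [seq nseq (mup x p) x | x <- rootsR p]) rs.
Proof.
have p0 : p != 0 by rewrite monic_neq0 ?monic_prod_XsubC.
apply/allP => x _ /=; rewrite count_flatten -!map_comp.
apply/eqP; rewrite sumnE big_map.
have memE : (x \in rootsR p) = (x \in rs).
  by rewrite -(roots_on_rootsR p0) in_itv /= root_prod_XsubC.
(* Only the block of [x] contains [x], and [rootsR p] is duplicate-free, so that block occurs at
   most once. *)
transitivity (\sum_(y <- rootsR p) (if y == x then count_mem x rs else 0)%N).
  apply: eq_bigr => y _; rewrite /= count_nseq mup_prod_XsubC /=.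
  by rewrite eq_sym; case: eqP => [->|]; rewrite ?mul1n.
rewrite -big_mkcond /= -big_filter.
have := filter_pred1_uniq (uniq_roots _ _ _ : uniq (rootsR p)).
case xr : (x \in rs); last first.
  by have/count_memPn -> := negbT xr; rewrite big1_eq.
by move=> -> ; rewrite ?memE ?xr // big_seq1.
Qed.

(** * Green's identities and positivity of the Laplacian *)

Section Green.
Variables (R : realType) (G : graph).

Lemma sum_adjC (F : G -> G -> R) :
  \sum_(x : G) \sum_(y | adj x y) F x y = \sum_(x : G) \sum_(y | adj x y) F y x.
Proof.
rewrite (exchange_big_dep xpredT) //=; apply: eq_bigr => y _.
by apply: eq_bigl => x; rewrite adj_sym.
Qed.

(** Self-adjointness: the terms [f x * g x] cancel, and what remains is antisymmetric under reversal
    of the oriented edges. *)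
Lemma laplacian_green (f g : G -> R) :
  \sum_x f x * (\sum_(y | adj x y) (g x - g y)) =
  \sum_x g x * (\sum_(y | adj x y) (f x - f y)).
Proof.
apply/eqP; rewrite -subr_eq0 -sumrB; apply/eqP.
transitivity (\sum_x \sum_(y | adj x y) (g x * f y - f x * g y)).
  apply: eq_bigr => x _; rewrite !mulr_sumr -sumrB.
  by apply: eq_bigr => y _; ring.
under eq_bigr do rewrite sumrB.
rewrite sumrB sum_adjC -sumrB big1 // => x _.
by rewrite -sumrB big1 // => y _; ring.
Qed.

(** Average over the two orientations of each edge, whence the factor one half. *)
Lemma laplacian_energy (f : G -> R) :
  \sum_x f x * (\sum_(y | adj x y) (f x - f y)) =
  2^-1 * \sum_x \sum_(y | adj x y) (f x - f y) ^+ 2.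
Proof.
pose S := \sum_x \sum_(y | adj x y) f x * (f x - f y).
have -> : \sum_x f x * (\sum_(y | adj x y) (f x - f y)) = S.
  by apply: eq_bigr => x _; rewrite mulr_sumr.
have -> : \sum_x \sum_(y | adj x y) (f x - f y) ^+ 2 = S + S.
  rewrite {2}/S [in RHS]sum_adjC /S -big_split; apply: eq_bigr => x _.
  by rewrite -big_split; apply: eq_bigr => y _ /=; ring.
by field.
Qed.

Lemma mul_laplacian_mx n (A : 'M[R]_(#|G|, n)) i j :
  (laplacian_mx R G *m A) i j =
  \sum_(y | adj (enum_val i) y) (A i j - A (enum_rank y) j).
Proof.
rewrite mulmxBl mul_diag_mx !mxE sumrB; congr (_ - _).
  by rewrite sumr_const /degree cardsE mulr_natl.
under eq_bigr do rewrite mxE.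
rewrite (reindex _ (onW_bij _ (enum_rank_bij G))) /= [RHS]big_mkcond.
by apply: eq_bigr => y _; rewrite enum_rankK; case: adj; rewrite ?mul1r ?mul0r.
Qed.

Lemma laplacian_mx_sym : (laplacian_mx R G)^T = laplacian_mx R G.
Proof.
rewrite /laplacian_mx linearB /= tr_diag_mx; congr (_ - _).
by apply/matrixP => i j; rewrite !mxE adj_sym.
Qed.

Lemma laplacian_mx_const (c : R) :
  laplacian_mx R G *m const_mx c = 0 :> 'cV[R]_#|G|.
Proof.
apply/matrixP => i j; rewrite mul_laplacian_mx !mxE big1 // => y _.
by rewrite !mxE subrr.
Qed.

Lemma laplacian_mx_eigenvalue_ge0 (mu : R) :
  eigenvalue (laplacian_mx R G) mu -> 0 <= mu.
Proof.
case/eigenvalueP => v vL v0; pose f x := v 0 (enum_rank x).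
have fL x : \sum_(y | adj x y) (f x - f y) = mu * f x.
  have : (laplacian_mx R G *m v^T) (enum_rank x) 0 = mu * f x.
    by rewrite -[X in X *m _]laplacian_mx_sym -trmx_mul vL !mxE.
  rewrite mul_laplacian_mx enum_rankK => <-.
  by apply: eq_bigr => y _; rewrite !mxE.
(* Rayleigh quotient: [mu] times the squared norm of [f] is a nonnegative energy. *)
have := laplacian_energy f; under eq_bigr do rewrite fL mulrCA.
rewrite -mulr_sumr => E.
have nrm_gt0 : 0 < \sum_x f x * f x.
  rewrite lt_neqAle sumr_ge0 ?andbT; last by move=> x _; rewrite -expr2 sqr_ge0.
  apply: contraNneq v0 => /esym/psumr_eq0P f0; apply/eqP/rowP => i; rewrite mxE.
  have := f0 (fun x _ => sqr_ge0 (f x)) (enum_val i) isT.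
  by rewrite /f enum_valK => /eqP; rewrite mulf_eq0 orbb => /eqP.
rewrite -(pmulr_lge0 _ nrm_gt0) E mulr_ge0 ?invr_ge0 //.
by apply: sumr_ge0 => x _; apply: sumr_ge0 => y _; apply: sqr_ge0.
Qed.

End Green.

(** * Edges at a vertex and double counting *)

Lemma sum_incident (R : nmodType) (G : graph) (x : G) (F : {set G} -> R) :
  \sum_(e : {e : {set G} | e \in edges G} | x \in val e) F (val e) =
  \sum_(y | adj x y) F [set x; y].
Proof.
rewrite -(big_sub_cond (mem (edges G)) (fun e : {set G} => x \in e)).
(* Edges at [x] correspond to neighbours of [x]; injectivity relies on the absence of loops. *)
pose h y := [set x; y]; have hinj : {in [set y | adj x y] &, injective h}.
  move=> y z; rewrite !inE => xy xz /setP/(_ y); rewrite !inE eqxx orbT.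
  by case/esym/orP => /eqP // yx; rewrite yx adj_irr in xy.
transitivity (\sum_(e in h @: [set y | adj x y]) F e); last first.
  by rewrite big_imset //=; apply: eq_bigl => y; rewrite inE.
apply: eq_bigl => e; apply/andP/imsetP => [[]|[y]]; rewrite !inE.
  case/existsP => y /existsP[z /andP[yz /eqP ->]]; rewrite !inE.
  case/orP => /eqP xE; first by exists z; rewrite ?inE /h xE.
  by exists y; rewrite ?inE /h xE; [rewrite adj_sym | rewrite finset.setUC].
move=> xy ->; split; last by rewrite !inE eqxx.
by apply/existsP; exists x; apply/existsP; exists y; rewrite xy eqxx.
Qed.

Lemma card_edge (G : graph) (e : {set G}) : e \in edges G -> #|e| = 2%N.
Proof.
rewrite inE => /existsP[x /existsP[y /andP[xy /eqP->]]]; rewrite cards2.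
by case: eqP => // xEy; rewrite xEy adj_irr in xy.
Qed.

Lemma handshake (G : graph) r : regular G r -> (2 * #|edges G| = #|G| * r)%N.
Proof.
move=> hr; transitivity (\sum_(e in edges G) \sum_(x in e) 1)%N.
  rewrite mulnC -sum_nat_const; apply: eq_bigr => e /card_edge <-.
  by rewrite sum1_card.
rewrite (big_sub (mem (edges G)) (fun e : {set G} => \sum_(x in e) 1)%N).
rewrite (exchange_big_dep xpredT) //= -[#|G|]/(#|xpredT : pred G|).
rewrite -sum_nat_const; apply: eq_bigr => x _.
by rewrite (@sum_incident nat _ x (fun=> 1%N)) -(hr x) /degree -sum1dep_card.
Qed.

(** * Kirchhoff index from a generalised inverse of the Laplacian *)

Lemma kirchhoff_index_of_inverse (R : realType) (H : graph)
    (M : H -> H -> R) (c : H -> R) :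
  (forall s w, \sum_(x | adj w x) (M w s - M x s) = (w == s)%:R - c w) ->
  kirchhoff_index R H = #|H|%:R * \sum_u M u u - \sum_u \sum_v M u v.
Proof.
move=> hM.
(* Pair [p] with column [s] of [M] in Green's identity. The resulting value does not depend on [s],
   so [p] is constant. *)
have harm p : (forall w, \sum_(x | adj w x) (p w - p x) = 0) ->
    forall s, p s = \sum_w p w * c w.
  move=> hp s; have := laplacian_green p (M^~ s).
  rewrite [RHS]big1 => [|w _]; last by rewrite hp mulr0.
  under eq_bigr do rewrite hM mulrBr; rewrite sumrB => /eqP; rewrite subr_eq0.
  move=> /eqP <-; rewrite (bigD1 s) //= eqxx mulr1 big1 ?addr0 //.
  by move=> w /negPf ->; rewrite mulr0.
pose f u v := (M u u - M u v) - (M v u - M v v).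
have resE u v : resistance_distance R u v = f u v.
  (* The difference of columns [u] and [v] of [M] is a potential, since [c] cancels. Any other
     potential differs from it by a harmonic function, hence by a constant. *)
  apply: xget_unique.
    exists (fun w => M w u - M w v) => // w; transitivity
      (\sum_(x | adj w x) ((M w u - M x u) - (M w v - M x v))).
      by apply: eq_bigr => x _; ring.
    by rewrite sumrB !hM; ring.
  move=> _ [p hp ->]; pose q w := p w - (M w u - M w v).
  have q0 w : \sum_(x | adj w x) (q w - q x) = 0.
    transitivity (\sum_(x | adj w x)
        ((p w - p x) - ((M w u - M x u) - (M w v - M x v)))).
      by apply: eq_bigr => x _; rewrite /q; ring.
    by rewrite sumrB hp sumrB !hM; ring.
  have : q u = q v by rewrite (harm _ q0) [RHS](harm _ q0).
  by rewrite /q /f; lra.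
have fC u v : f u v = f v u by rewrite /f; ring.
have fx u : f u u = 0 by rewrite /f; ring.
pose K := \sum_(u : H) \sum_(v : H | (enum_rank u < enum_rank v)%N) f u v.
have -> : kirchhoff_index R H = K.
  by apply: eq_bigr => u _; apply: eq_bigr => v _; apply: resE.
(* By symmetry and the zero diagonal of [f], the sum over ordered pairs counts each unordered pair
   twice. *)
have K2 : \sum_u \sum_v f u v = K + K.
  rewrite {2}/K [in RHS](exchange_big_dep xpredT) //= /K -big_split.
  apply: eq_bigr => u _ /=.
  rewrite (bigID (fun v => enum_rank u < enum_rank v)%N) /=; congr (_ + _).
  rewrite [LHS](bigD1 u) ?ltnn //= fx add0r; apply: eq_big => v; last by rewrite fC.
  by rewrite -leqNgt ltn_neqAle andbC -(inj_eq (@enum_rank_inj H)).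
apply: (mulfI (_ : 2 != 0 :> R)); first by rewrite pnatr_eq0.
transitivity (\sum_u \sum_v f u v); first by rewrite K2; ring.
have -> : \sum_u \sum_v f u v =
    \sum_(u : H) \sum_(v : H) M u u - \sum_u \sum_v M u v -
    (\sum_u \sum_v M v u - \sum_(u : H) \sum_(v : H) M v v).
  by rewrite -!sumrB; apply: eq_bigr => u _; rewrite -!sumrB.
rewrite [X in _ - (X - _)]exchange_big /=.
have -> : \sum_(u : H) \sum_(v : H) M u u = #|H|%:R * \sum_u M u u.
  by rewrite mulr_sumr; apply: eq_bigr => u _; rewrite sumr_const mulr_natl.
by rewrite sumr_const -[_ *+ _]mulr_natl; ring.
Qed.

(** * Resolvent of the Laplacian *)

Lemma laplacian_shift_unit (R : realType) (G : graph) (a : R) :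
  0 < a -> a%:M + laplacian_mx R G \in unitmx.
Proof.
(* A singular shift would make the negative number [- a] an eigenvalue. *)
move=> a0; have : ~~ eigenvalue (laplacian_mx R G) (- a).
  by apply/negP => /laplacian_mx_eigenvalue_ge0; rewrite oppr_ge0 leNgt a0.
rewrite /eigenvalue /eigenspace negbK kermx_eq0 row_free_unit.
by rewrite raddfN opprK addrC.
Qed.

Lemma laplacian_mx_eigenvalue0 (R : realType) (G : graph) :
  eigenvalue (laplacian_mx R G) 0.
Proof.
apply/eigenvalueP; exists (const_mx 1); last first.
  apply/eqP => /rowP/(_ (Ordinal (vertex_gt0 G))); rewrite !mxE => /eqP.
  by rewrite oner_eq0.
rewrite scale0r; apply: trmx_inj.
by rewrite trmx_mul laplacian_mx_sym trmx_const laplacian_mx_const trmx0.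
Qed.

(** The isolated term [a^-1] is the contribution of the eigenvalue 0, which heads the sorted
    spectrum. *)
Lemma trace_resolvent (R : realType) (G : graph) (a : R) : 0 < a ->
  \tr (invmx (a%:M + laplacian_mx R G)) =
  a^-1 + \sum_(2 <= i < #|G|.+1) 1 / (a + laplacian_eigenvalue R G i).
Proof.
move=> a0; have [rs chE ->] := symmetric_mx_spectrum (laplacian_mx_sym R G);
  last exact: laplacian_shift_unit.
rewrite /laplacian_eigenvalue; set s := laplacian_spectrum R G.
have sP : perm_eq s rs.
  by rewrite /s /laplacian_spectrum chE perm_sort perm_rootsR_mup.
have s_sorted : sorted <=%R s by apply: sort_sorted; apply: le_total.
have s_eig x : (x \in s) = eigenvalue (laplacian_mx R G) x.
  by rewrite eigenvalue_root_char chE root_prod_XsubC (perm_mem sP).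
have size_s : size s = #|G|.
  have := size_char_poly (laplacian_mx R G).
  by rewrite chE size_prod_XsubC (perm_size sP) => -[].
rewrite -(perm_big _ sP) /= -size_s => {sP size_s}.
have := s_eig 0; rewrite laplacian_mx_eigenvalue0.
have s_ge0 x : x \in s -> 0 <= x.
  by rewrite s_eig; apply: laplacian_mx_eigenvalue_ge0.
move: s s_sorted s_ge0 {s_eig} => [|x s] //= s_sorted s_ge0 s0.
have -> : x = 0.
  apply/eqP; rewrite eq_le s_ge0 ?mem_head // andbT.
  move: s0; rewrite inE => /orP[/eqP<-//|s0].
  by have /allP/(_ 0 s0) := order_path_min le_trans s_sorted.
(* Eigenvalue number [i] sits at position [i.-1], so the sum from 2 runs exactly over the tail of
   the list. *)
rewrite big_cons addr0 (big_nth 0) big_add1 /= big_add1 /=; congr (_ + _).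
by apply: eq_bigr => i _; rewrite div1r.
Qed.

Lemma laplacian_resolvent (R : realType) (G : graph) (a : R) : 0 < a ->
  exists Q : G -> G -> R,
  [/\ forall v w, a * Q w v + \sum_(x | adj w x) (Q w v - Q x v) = (w == v)%:R,
      forall v, \sum_u Q u v = a^-1
    & \sum_u Q u u =
      a^-1 + \sum_(2 <= i < #|G|.+1) 1 / (a + laplacian_eigenvalue R G i)].
Proof.
move=> a0; set A := a%:M + laplacian_mx R G.
have Aunit : A \in unitmx by apply: laplacian_shift_unit.
pose Q (u v : G) := invmx A (enum_rank u) (enum_rank v).
have QL v w : a * Q w v + \sum_(x | adj w x) (Q w v - Q x v) = (w == v)%:R.
  have /matrixP/(_ (enum_rank w) (enum_rank v)) := mulmxV Aunit.
  rewrite {1}/A mulmxDl mul_scalar_mx [LHS]mxE mul_laplacian_mx !mxE.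
  by rewrite enum_rankK (inj_eq enum_rank_inj).
exists Q; split=> // [v|].
  (* Sum the resolvent equation over [w]: the Laplacian part vanishes by Green's identity against
     the constant 1. *)
  apply: (mulfI (lt0r_neq0 a0)); rewrite mulfV ?gt_eqF //.
  have <- : \sum_w (a * Q w v + \sum_(x | adj w x) (Q w v - Q x v)) = 1.
    under eq_bigr do rewrite QL.
    by rewrite (bigD1 v) //= eqxx big1 ?addr0 // => w /negPf ->.
  rewrite big_split /= -mulr_sumr -[LHS]addr0; congr (_ + _); apply/esym.
  transitivity (\sum_w 1 * \sum_(x | adj w x) (Q w v - Q x v)).
    by apply: eq_bigr => w _; rewrite mul1r.
  rewrite (laplacian_green (fun=> 1)) big1 // => w _.
  by rewrite big1 ?mulr0 // => x _; rewrite subrr.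
rewrite -trace_resolvent //.
by rewrite /mxtrace (reindex _ (onW_bij _ (enum_rank_bij G))).
Qed.

(** * Sums over edges and their ends *)

Lemma sum_edge_ends (R : nmodType) (G : graph) (F : G -> {set G} -> R) :
  \sum_(e : {e : {set G} | e \in edges G}) \sum_(x in val e) F x (val e) =
  \sum_x \sum_(y | adj x y) F x [set x; y].
Proof.
rewrite (exchange_big_dep xpredT) //=; apply: eq_bigr => x _.
exact: sum_incident.
Qed.

Lemma sum_delta (R : nzRingType) (I : finType) (A : pred I) (j : I) :
  \sum_(i | A i) (i == j)%:R = (A j)%:R :> R.
Proof.
rewrite big_mkcond (bigD1 j) //= eqxx big1 ?addr0 => [|i /negPf ->].
  by case: (A j).
by case: (A i).
Qed.

Lemma sum_pair (V : nmodType) (G : graph) (F : G -> V) (x y : G) :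
  adj x y -> \sum_(z in [set x; y]) F z = F x + F y.
Proof.
move=> xy; rewrite big_setU1 ?big_set1 // inE.
by apply: contraTneq xy => ->; rewrite adj_irr.
Qed.

Lemma sum_edge_const (R : nzRingType) (G : graph)
    (e : {e : {set G} | e \in edges G}) (a : R) :
  \sum_(x in val e) a = 2 * a.
Proof. by rewrite sumr_const (card_edge (valP e)) mulr_natl. Qed.

Lemma sum_regular (R : nzRingType) (G : graph) (r : nat) (a : R) (x : G) :
  regular G r -> \sum_(y | adj x y) a = r%:R * a.
Proof. by move=> hr; rewrite sumr_const -cardsE -/(degree x) hr mulr_natl. Qed.

(** * Generalised inverse for the subdivision-vertex join *)

Section Join.
Variables (R : realType) (G1 G2 : graph).
Local Notation J := (subdivision_vertex_join G1 G2).
Local Notation E1 := {e : {set G1} | e \in edges G1}.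

Lemma sum_svjoin (P : pred J) (F : J -> R) :
  \sum_(w | P w) F w =
  \sum_(x : G1 | P (inl (inl x))) F (inl (inl x)) +
  \sum_(e : E1 | P (inl (inr e))) F (inl (inr e)) +
  \sum_(z : G2 | P (inr z)) F (inr z).
Proof.
by etransitivity; [apply: big_sumType|]; congr (_ + _); apply: big_sumType.
Qed.

Lemma card_edge_type : #|{: E1}| = #|edges G1|.
Proof. by rewrite card_sig; apply: eq_card => e; rewrite inE. Qed.

Lemma card_svjoin : #|J| = (#|G1| + #|edges G1| + #|G2|)%N.
Proof. by rewrite !card_sum card_edge_type. Qed.

Lemma svjoin_laplacian (p : J -> R) (w : J) :
  \sum_(x | adj w x) (p w - p x) =
  match w with
  | inl (inl x) =>
      \sum_(e : E1 | x \in val e) (p w - p (inl (inr e))) +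
      \sum_(z : G2) (p w - p (inr z))
  | inl (inr e) => \sum_(x in val e) (p w - p (inl (inl x)))
  | inr z =>
      \sum_(x : G1) (p w - p (inl (inl x))) +
      \sum_(z' | adj z z') (p w - p (inr z'))
  end.
Proof.
by rewrite sum_svjoin; case: w => [[x|e]|z] /=;
  rewrite ?big_pred0_eq ?add0r ?addr0.
Qed.

Variables (P : G1 -> G1 -> R) (Q : G2 -> G2 -> R).

Let k1 : R := #|G1|%:R.
Let k2 : R := #|G2|%:R.

Let k1_neq0 : k1 != 0.
Proof. by rewrite pnatr_eq0 -lt0n vertex_gt0. Qed.

Let k2_neq0 : k2 != 0.
Proof. by rewrite pnatr_eq0 -lt0n vertex_gt0. Qed.

(** An edge vertex has degree two and receives no current here, so its potential is the mean of the
    values [2 * P x y] at its two ends. *)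
Definition svjoin_inverse_vertex (y : G1) (w : J) : R :=
  match w with
  | inl (inl x) => 2 * P x y
  | inl (inr e) => \sum_(x in val e) P x y
  | inr _ => 0
  end.

(* The column of an edge is the mean of the columns of its two ends, corrected
   by half a unit at the edge itself. *)
Definition svjoin_inverse (w v : J) : R :=
  match v with
  | inl (inl y) => svjoin_inverse_vertex y w
  | inl (inr f) =>
      2^-1 *
      (\sum_(y in val f) svjoin_inverse_vertex y w + (w == inl (inr f))%:R)
  | inr z => if w is inr z' then Q z' z - (k1 * k2)^-1 else 0
  end.

(** This is the vector [c]. Columns of a Laplacian sum to zero, so [c] must have total mass one; it
    is spread evenly over [G2]. *)
Definition svjoin_defect (w : J) : R := if w is inr _ then k2^-1 else 0.

Hypothesis PL : forall v w,
  2 * k2 * P w v + \sum_(x | adj w x) (P w v - P x v) = (w == v)%:R.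
Hypothesis P_sum : forall v, \sum_u P u v = (2 * k2)^-1.
Hypothesis QL : forall v w,
  k1 * Q w v + \sum_(x | adj w x) (Q w v - Q x v) = (w == v)%:R.
Hypothesis Q_sum : forall v, \sum_u Q u v = k1^-1.

(** At an original vertex [x], the current through an edge to [x'] is [P x y - P x' y] and the
    current into [G2] is [2 * k2 * P x y]; together they form the resolvent equation [PL]. *)
Lemma svjoin_inverse_vertexP (y : G1) (w : J) :
  \sum_(x | adj w x) (svjoin_inverse_vertex y w - svjoin_inverse_vertex y x) =
  (w == inl (inl y))%:R - svjoin_defect w.
Proof.
rewrite svjoin_laplacian; case: w => [[x|e]|z] /=.
- rewrite !subr0 -[_ == _]/(x == y) -(PL y x) [RHS]addrC; congr (_ + _).
    rewrite (sum_incident x (fun e => 2 * P x y - \sum_(x in e) P x y)).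
    by apply: eq_bigr => x' xx'; rewrite sum_pair //; ring.
  by rewrite sumr_const -[_ *+ _]mulr_natl -/k2; ring.
- by rewrite subr0 sumrB sum_edge_const -mulr_sumr subrr.
- under eq_bigr do rewrite sub0r -mulNr; rewrite -mulr_sumr P_sum.
  rewrite big1 => [|z' _]; last by rewrite subrr.
  by field.
Qed.

(** For an edge column [f], the mean of the end columns injects half a unit at each end. The half
    unit of potential at [f] cancels both and injects one unit at [f]. *)
Lemma svjoin_inverseP (v w : J) :
  \sum_(x | adj w x) (svjoin_inverse w v - svjoin_inverse x v) =
  (w == v)%:R - svjoin_defect w.
Proof.
case: v => [[y|f]|z]; first exact: svjoin_inverse_vertexP.
- transitivity (2^-1 * (\sum_(y in val f) \sum_(x | adj w x)
       (svjoin_inverse_vertex y w - svjoin_inverse_vertex y x) +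
       \sum_(x | adj w x)
         ((w == inl (inr f))%:R - (x == inl (inr f) :> J)%:R))).
    rewrite exchange_big -big_split mulr_sumr; apply: eq_bigr => x _ /=.
    by rewrite sumrB; ring.
  under eq_bigr do rewrite svjoin_inverse_vertexP.
  rewrite sumrB sum_edge_const svjoin_laplacian; case: w => [[x|e]|z] /=.
  + under eq_bigr do rewrite eq_sym -[_ == _]/(_ == x).
    rewrite sum_delta !subr0 [\sum_(z : G2) _]big1_eq addr0.
    under eq_bigr do rewrite sub0r -[_ == _]/(_ == f).
    by rewrite sumrN sum_delta; ring.
  + rewrite big1 // subr0 sum_edge_const -[_ == _]/(e == f).
    by field.
  + rewrite !big1 => [|z' _|x _|y _]; rewrite ?subrr //.
    by field; apply: k2_neq0.
(* Subtracting [(k1 * k2)^-1] makes the column sum to zero over [G2], so no current is left at [G1];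
   multiplied by [k1] it produces the defect on [G2]. *)
- rewrite svjoin_laplacian; case: w => [[x|e]|z'] /=.
  + rewrite !subr0 big1 // add0r sumrB big1 // sumrB Q_sum sumr_const.
    rewrite -[_ *+ _]mulr_natl -/k2.
    by field; apply/andP.
  + by rewrite subr0 big1 // => x _; rewrite subrr.
  + rewrite !subr0 sumr_const -[_ *+ _]mulr_natl -/k1.
    rewrite -[_ == _]/(z' == z) -(QL z z').
    under eq_bigr do rewrite opprB addrA subrK.
    by field; apply/andP.
Qed.

Variable r : nat.
Hypothesis G1_regular : regular G1 r.

Let m : R := #|edges G1|%:R.

(** The edge block needs the trace of [P B B^T]. With [B B^T = 2 r - L1] and [L1 P = I - 2 k2 P], it
    equals [2 (r + k2) tr P - k1]. *)
Lemma svjoin_inverse_trace :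
  \sum_w svjoin_inverse w w =
  (2 + r%:R + k2) * (\sum_x P x x) + (m - k1) / 2 + \sum_z Q z z - k1^-1.
Proof.
rewrite sum_svjoin /=; under [\sum_(e : E1) _]eq_bigr do rewrite eqxx mulrDr.
rewrite big_split /= -!mulr_sumr sumr_const card_edge_type -/m.
rewrite (sum_edge_ends (fun y e => \sum_(x in e) P x y)).
have -> : \sum_y \sum_(x | adj y x) \sum_(z in [set y; x]) P z y =
    2 * (r%:R + k2) * (\sum_x P x x) - k1.
  have -> : k1 = \sum_(y : G1) 1 by rewrite sumr_const.
  rewrite mulr_sumr -sumrB; apply: eq_bigr => y _.
  have PLy : 2 * k2 * P y y + (r%:R * P y y - \sum_(x | adj y x) P x y) = 1.
    by rewrite -(sum_regular _ y G1_regular) -sumrB PL eqxx.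
  under eq_bigr => x yx do rewrite sum_pair //.
  by rewrite big_split /= (sum_regular _ _ G1_regular); lra.
rewrite sumrB sumr_const -[_ *+ #|G2|]mulr_natl -/k2.
by field; apply/andP.
Qed.

(** Every [G1] vertex column has the same sum, as each vertex lies on [r] edges. An edge column
    averages two of these and adds one half, and the [G2] columns sum to zero. *)
Lemma svjoin_inverse_total :
  \sum_u \sum_v svjoin_inverse u v = (k1 + m) * (2 + r%:R) / (2 * k2) + m / 2.
Proof.
have colE y : \sum_w svjoin_inverse_vertex y w = (2 + r%:R) / (2 * k2).
  rewrite sum_svjoin /= big1_eq addr0 -mulr_sumr P_sum.
  rewrite (sum_edge_ends (fun x _ => P x y)).
  under [\sum_x \sum_(_ | _) _]eq_bigr do
    rewrite (sum_regular _ _ G1_regular).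
  by rewrite -mulr_sumr P_sum; field.
rewrite exchange_big sum_svjoin /=.
under eq_bigr do rewrite colE.
under [\sum_(e : E1) _]eq_bigr => e _.
  rewrite -mulr_sumr big_split /= exchange_big /= sum_delta -[true%:R]/1.
  under eq_bigr do rewrite colE.
  rewrite sum_edge_const; over.
rewrite !sumr_const card_edge_type [X in _ + X]big1 => [|z _]; last first.
  rewrite sum_svjoin /= !big1_eq !add0r sumrB Q_sum sumr_const.
  by rewrite -[_ *+ _]mulr_natl -/k2; field; apply/andP.
rewrite -[_ *+ #|G1|]mulr_natl -[_ *+ #|edges G1|]mulr_natl -/k1 -/m.
by field.
Qed.

End Join.

Theorem corollary2p10 (R : realType) (G1 G2 : graph) (r1 n1 m1 n2 : nat)
    (hreg : regular G1 r1) (hn1 : #|G1| = n1) (hm1 : #|edges G1| = m1)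
    (hn2 : #|G2| = n2) :
  kirchhoff_index R (subdivision_vertex_join G1 G2) =
    (m1%:R + n1%:R + n2%:R) *
    ((m1%:R - n1%:R) / 2
     + (2 + r1%:R + n1%:R + n2%:R) / (2 * n1%:R + 2 * n2%:R + n1%:R * r1%:R)
     + \sum_(2 <= i < n2.+1) 1 / (n1%:R + laplacian_eigenvalue R G2 i)
     + \sum_(2 <= i < n1.+1)
         (2 + r1%:R + n2%:R) / (2 * n2%:R + laplacian_eigenvalue R G1 i)).
Proof.
have [n1_gt0 n2_gt0] : 0 < n1%:R :> R /\ 0 < n2%:R :> R.
  by rewrite !ltr0n -hn1 -hn2 !vertex_gt0.
have n2x2_gt0 : 0 < 2 * n2%:R :> R by rewrite mulr_gt0.
have [P [PL P_sum trP]] := laplacian_resolvent G1 n2x2_gt0.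
have [Q [QL Q_sum trQ]] := laplacian_resolvent G2 n1_gt0.
rewrite -hn1 in QL Q_sum; rewrite -hn2 in PL P_sum.
rewrite (kirchhoff_index_of_inverse (svjoin_inverseP PL P_sum QL Q_sum)).
rewrite (svjoin_inverse_trace Q PL hreg).
rewrite (svjoin_inverse_total P_sum Q_sum hreg).
rewrite trP trQ card_svjoin hn1 hn2 hm1 !natrD.
set S1 := \sum_(2 <= i < n1.+1) 1 / _; set S2 := \sum_(2 <= i < n2.+1) _.
have -> : \sum_(2 <= i < n1.+1) (2 + r1%:R + n2%:R) /
    (2 * n2%:R + laplacian_eigenvalue R G1 i) = (2 + r1%:R + n2%:R) * S1.
  by rewrite mulr_sumr; apply: eq_bigr => i _; rewrite mulrA mulr1.
(* The denominator becomes [2 (n1 + n2 + m1)], twice the order of the join, so the second fraction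
   cancels against the outer factor. *)
have -> : n1%:R * r1%:R = 2 * m1%:R :> R.
  by rewrite -!natrM -hn1 -hm1 (handshake hreg).
have m1_ge0 := ler0n R m1.
(* Eliminating [r1] leaves a rational identity in [n1], [m1], [n2] and the two spectral sums, with
   positive denominators. *)
have r1E : r1%:R = 2 * m1%:R / n1%:R :> R.
  by rewrite -natrM -hm1 (handshake hreg) hn1 natrM mulrC mulKf ?gt_eqF.
by rewrite r1E; field; apply/and3P; split; rewrite gt_eqF //; lra.
Qed.
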